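(* Let $n \ge 2$ and let $m$ be an integer with $3 \le m \le n-1$. Let $T$ be a subgraph of $K_n$ isomorphic to the tadpole graph $T_{m,1}$, and let $G$ be the graph on the same $n$ vertices obtained from $K_n$ by deleting the edges of $T$. Then $G$ has a path decomposition consisting of at most $\left\lfloor \frac{n+1}{2} \right\rfloor$ paths.
   Context: The tadpole graph $T_{m,1}$ ($m \ge 3$) is the graph obtained from a cycle $C_m$ by joining one vertex of the cycle by a single edge to a new vertex (so it has $m+1$ vertices and $m+1$ edges). A path decomposition of a graph $G$ is a collection of paths (subgraphs of $G$) such that every edge of $G$ belongs to exactly one path in the collection. *)

(* Defs.v *)
From HB Require Import structures.
From mathcomp Require Import all_boot.

Set Implicit Arguments.
Unset Strict Implicit.
Unset Printing Implicit Defensive.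

Section Graphs.
Variable V : finType.

Definition graph_axiom (G : {set V} * {set {set V}}) : bool :=
  [forall e in G.2, (e \subset G.1) && (#|e| == 2)].

(* A finite simple graph whose vertices form a subset of V. Subgraphs have
   their own vertex set, so they live in the same type as the ambient graph;
   being a subtype of a finType, this type is itself a finType. *)
Record graph : Type :=
  Graph { graph_val : {set V} * {set {set V}}; _ : graph_axiom graph_val }.

HB.instance Definition _ := [isSub for graph_val].
HB.instance Definition _ := [Finite of graph by <:].

Definition vertices (G : graph) : {set V} := (graph_val G).1.
Definition edges (G : graph) : {set {set V}} := (graph_val G).2.

Definition subgraph (H G : graph) : bool :=
  (vertices H \subset vertices G) && (edges H \subset edges G).

Lemma del_edges_subproof (G : graph) (F : {set {set V}}) :
  graph_axiom (vertices G, edges G :\: F).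
Proof.
have /forall_inP Gax := valP G; apply/forall_inP => e /=.
by rewrite inE => /andP[_]; apply: Gax.
Qed.

Definition del_edges (G : graph) (F : {set {set V}}) : graph :=
  Graph (del_edges_subproof G F).

Definition rel_edges (r : rel V) : {set {set V}} :=
  [set e : {set V} | [exists u, exists v, [&& u != v, r u v & e == [set u; v]]]].

Lemma rel_graph_subproof (r : rel V) : graph_axiom (setT, rel_edges r).
Proof.
apply/forall_inP => e /=; rewrite inE => /existsP[u /existsP[v]].
by case/and3P=> uv _ /eqP->; rewrite subsetT cards2 uv.
Qed.

(* The graph on all of V in which distinct u, v are adjacent iff
   r u v or r v u (see rel_graphE); r need not be symmetric. *)
Definition rel_graph (r : rel V) : graph := Graph (rel_graph_subproof r).

Lemma rel_graphE (r : rel V) (u v : V) :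
  ([set u; v] \in edges (rel_graph r)) = (u != v) && (r u v || r v u).
Proof.
rewrite inE; apply/existsP/andP => [[x /existsP[y]]|[uv]].
  case/and3P=> xy rxy /eqP E.
  have uv : u != v.
    by apply/eqP => uv; move: (cards2 x y); rewrite -E uv setUid cards1 xy.
  have := set21 u v; have := set22 u v; rewrite E !inE.
  move: uv; case: (eqVneq v x) => [->|_] /= uv.
    by rewrite (negPf uv) /= => _ /eqP->; rewrite rxy orbT.
  move/eqP=> vy; move: uv; rewrite vy => uy.
  by rewrite (negPf uy) orbF => /eqP->; rewrite rxy.
case/orP=> ruv; [exists u | exists v]; apply/existsP; [exists v | exists u].
  by rewrite uv ruv eqxx.
by rewrite eq_sym uv ruv setUC eqxx.
Qed.

End Graphs.

Definition isomorphic (V W : finType) (G : graph V) (H : graph W) : Prop :=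
  exists f : {x : V | x \in vertices G} -> {y : W | y \in vertices H},
    bijective f /\
    forall x y, ([set val x; val y] \in edges G) =
                ([set val (f x); val (f y)] \in edges H).

Definition complete_graph (n : nat) : graph 'I_n := rel_graph (fun _ _ => true).

Definition path_graph (k : nat) : graph 'I_k :=
  rel_graph (fun i j : 'I_k => j == i.+1 :> nat).

Definition cycle_rel (m : nat) : rel 'I_m :=
  fun i j => j == i.+1 %% m :> nat.

(* None is the pendant vertex, joined to the vertex 0 of the cycle; this is
   the tadpole graph T_{m,1} when m >= 3. *)
Definition tadpole_graph (m : nat) : graph (option 'I_m) :=
  rel_graph (fun x y : option 'I_m =>
    match x, y with
    | Some i, Some j => cycle_rel i j
    | Some i, None => i == 0 :> nat
    | None, _ => false
    end).

(* Single-vertex paths (k = 1) are allowed, the null graph is not. *)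
Definition is_path (V : finType) (P : graph V) : Prop :=
  exists2 k : nat, 0 < k & isomorphic P (path_graph k).

Definition path_decomposition (V : finType) (G : graph V)
    (D : {set graph V}) : Prop :=
  (forall P, P \in D -> is_path P /\ subgraph P G) /\
  (forall e, e \in edges G -> exists! P, P \in D /\ e \in edges P).

(* Main.v *)
Require Import Defs.
From mathcomp Require Import all_boot.
From mathcomp Require Import fingroup perm zify.

(* Write n = 2k or n = 2k + 1.  The complete graph on {0, ..., 2k - 1} is the
   union of the k zigzag Hamiltonian paths c, c + 1, c - 1, c + 2, c - 2, ...,
   c + k (mod 2k), and every vertex is an end of exactly one of them.  Let C_m
   consist of the edges {j, j + 2} for j <= m - 3, {0, 1} and {m - 2, m - 1}.
   Removing {i - 1, i + 1} from the path ending at i leaves the edge {i, i + 1}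
   loose; the path ending at i + 1 can take it over.  The changes telescope, and
   the graph without C_m is still covered by k paths with ends at all vertices.

   For n = 2k, the pendant edge {1, 2k - 1} is the first edge of path 0.  For
   n = 2k + 1, close every path to a cycle through the new vertex 2k, except that
   one path is extended at one end only, the pendant edge {0, 2k} being deleted.
   Each of the remaining k - 1 cycles is opened at one edge, chosen so that
   these k - 1 edges form one further path 0, 5, 2, 7, 4, ...  This needs
   4 <= k; the orders 4, 5 and 7 are settled by explicit paths. *)

Set Implicit Arguments.
Unset Strict Implicit.
Unset Printing Implicit Defensive.

(** * Paths as sequences *)

Definition steps (A : Type) (s : seq A) : seq (A * A) := zip s (behead s).

Lemma steps_map (A B : Type) (f : A -> B) (s : seq A) :
  steps (map f s) = [seq (f p.1, f p.2) | p <- steps s].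
Proof. by elim: s => //= a [|b s] //= IH; rewrite [LHS]/steps /= -/(steps (f b :: map f s)) IH. Qed.

Lemma steps_nth (A : Type) (a : A) (s : seq A) :
  steps s = mkseq (fun i => (nth a s i, nth a s i.+1)) (size s).-1.
Proof.
case: s => // b s; rewrite /steps /=; elim: s b => //= c s IH b.
by rewrite IH /mkseq /= (iotaDl 1) -map_comp.
Qed.

Lemma mem_steps (A : eqType) (s : seq A) (x y : A) : uniq s ->
  ((x, y) \in steps s) =
  [&& x \in s, y \in s & index y s == (index x s).+1].
Proof.
move=> us; rewrite (steps_nth x); apply/mapP/and3P => [[i]|[xs ys /eqP yE]].
  rewrite mem_iota add0n /= => i_s [-> ->].
  by rewrite !mem_nth ?index_uniq //; lia.
exists (index x s); last by rewrite -yE !nth_index.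
by rewrite mem_iota add0n; move: ys; rewrite -index_mem yE; lia.
Qed.

(* The default [G0] only serves to make the construction total. *)
Definition seq_graph (V : finType) (G0 : graph V) (s : seq V) : graph V :=
  insubd G0 ([set x in s], rel_edges (fun x y => (x, y) \in steps s)).

Section SeqGraph.
Variables (V : finType) (G0 : graph V) (s : seq V).
Hypotheses (us : uniq s).

Lemma seq_graph_val : graph_val (seq_graph G0 s) =
  ([set x in s], rel_edges (fun x y => (x, y) \in steps s)).
Proof.
rewrite [LHS]val_insubd ifT //.
apply/forall_inP => e /=; rewrite inE => /existsP[u /existsP[v]].
case/and3P=> uv; rewrite mem_steps // => /and3P[xs ys _] /eqP->.
by rewrite cards2 uv subUset !sub1set !in_set xs ys.
Qed.

Lemma seq_graph_vertices : vertices (seq_graph G0 s) = [set x in s].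
Proof. by rewrite /vertices seq_graph_val. Qed.

Lemma seq_graph_edges x y : ([set x; y] \in edges (seq_graph G0 s)) =
  (x != y) && (((x, y) \in steps s) || ((y, x) \in steps s)).
Proof.
by rewrite /edges seq_graph_val (rel_graphE (fun x y => (x, y) \in steps s)).
Qed.

Lemma seq_graph_path : s != [::] -> is_path (seq_graph G0 s).
Proof.
move=> s0; have s_gt0 : 0 < size s by case: s s0.
have [x0 _] : exists x0, x0 \in s by case: s s0 => // x0 s' _; exists x0; rewrite mem_head.
exists (size s) => //.
have inS (x : {x | x \in vertices (seq_graph G0 s)}) : val x \in s.
  by case: x => x /=; rewrite seq_graph_vertices inE.
have idxP (x : {x | x \in vertices (seq_graph G0 s)}) : index (val x) s < size s.
  by rewrite index_mem inS.
have nthP (y : {y : 'I_(size s) | y \in vertices (path_graph (size s))}) :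
    nth x0 s (val y) \in vertices (seq_graph G0 s).
  by rewrite seq_graph_vertices inE mem_nth.
pose f x : {y : 'I_(size s) | y \in vertices (path_graph (size s))} :=
  exist _ (Ordinal (idxP x)) (in_setT _).
pose g y : {x | x \in vertices (seq_graph G0 s)} := exist (fun x => x \in _) _ (nthP y).
exists f; split.
  exists g => [x|y]; apply/val_inj; first by rewrite /= nth_index ?inS.
  by apply/val_inj; rewrite /= index_uniq.
move=> x y; rewrite seq_graph_edges !mem_steps // rel_graphE !inS /=.
congr (~~ _ && _); apply/eqP/eqP => [xy|[]]; first by apply/val_inj; rewrite /= xy.
by move/(congr1 (nth x0 s)); rewrite !nth_index ?inS.
Qed.

End SeqGraph.

(** Sorting the ends gives every undirected edge a single representative, so that multiplicities can
    be counted. *)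
Definition norm_pair (p : nat * nat) : nat * nat := (minn p.1 p.2, maxn p.1 p.2).

Definition seq_edges (s : seq nat) : seq (nat * nat) := map norm_pair (steps s).

Definition family_edges (L : seq (seq nat)) : seq (nat * nat) :=
  flatten (map seq_edges L).

(** With [R x y] read as 0 or 1, each edge is covered exactly once and no other pair at all. Being
    boolean, the condition can be evaluated for the small orders. *)
Definition seq_decomposition (n : nat) (R : rel nat) (L : seq (seq nat)) : bool :=
  all (fun s => [&& s != [::], uniq s & all (gtn n) s]) L &&
  all (fun y => all (fun x =>
    count_mem (x, y) (family_edges L) == R x y) (iota 0 y)) (iota 0 n).

Lemma mem_seq_edges (s : seq nat) (x y : nat) : x < y ->
  ((x, y) \in seq_edges s) = ((x, y) \in steps s) || ((y, x) \in steps s).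
Proof.
move=> xy; apply/mapP/orP => [[[a b] abs]|[] abs].
- by rewrite /norm_pair /=; case: leqP => ab [-> ->]; rewrite abs; [left | right].
- by exists (x, y) => //; congr (_, _) => /=; lia.
by exists (y, x) => //; congr (_, _) => /=; lia.
Qed.

Lemma count_flatten_gt1 (A B : eqType) (g : A -> seq B) (L : seq A) (a b : A) (e : B) :
  a \in L -> b \in L -> a != b -> e \in g a -> e \in g b ->
  1 < count_mem e (flatten (map g L)).
Proof.
move=> aL bL ab ea eb; rewrite (perm_mem (perm_to_rem aL)) in_cons eq_sym (negPf ab) in bL.
rewrite (seq.permP (perm_flatten (perm_map g (perm_to_rem aL)))) /= count_cat.
have : e \in flatten (map g (rem a L)) by apply/flatten_mapP; exists b.
by rewrite -!has_pred1 !has_count in ea *; lia.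
Qed.

(** Multiplicity 1 gives a path through each edge, and a second sequence through it would raise the
    count to 2, whence uniqueness; multiplicity 0 keeps the paths inside [G]. *)
Lemma seq_decompositionP (V : finType) (n : nat) (R : rel nat) (L : seq (seq nat))
    (psi : V -> nat) (phi : nat -> V) (G : graph V) :
  (forall x, psi x < n) -> cancel psi phi -> (forall z, z < n -> psi (phi z) = z) ->
  vertices G = setT ->
  (forall x y, psi x < psi y -> ([set x; y] \in edges G) = R (psi x) (psi y)) ->
  seq_decomposition n R L ->
  exists2 D : {set graph V}, path_decomposition G D & #|D| <= size L.
Proof.
move=> psi_n psiK phiK GT GR /andP[/allP Lok /allP Lcount].
have psi_inj := can_inj psiK.
have countE x y : psi x < psi y ->
    count_mem (psi x, psi y) (family_edges L) = R (psi x) (psi y).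
  move=> xy; apply/eqP.
  by apply: (allP (Lcount (psi y) _)); rewrite mem_iota ?add0n ?psi_n.
have edgeW (H : graph V) e : e \in edges H -> exists x y, psi x < psi y /\ e = [set x; y].
  move=> eH; have /forall_inP Hax := valP H; have /andP[_ /cards2P[x [y [xy eE]]]] := Hax e eH.
  have [?|?|/psi_inj] := ltngtP (psi x) (psi y); first by exists x, y.
    by exists y, x; rewrite setUC.
  by move/eqP; rewrite (negPf xy).
pose F s := seq_graph G (map phi s).
have usE s : s \in L -> uniq (map phi s).
  move=> /Lok/and3P[_ us /allP s_n]; rewrite map_inj_in_uniq // => x y /s_n x_n /s_n y_n.
  by move/(congr1 psi); rewrite !phiK.
have FE s x y : s \in L -> psi x < psi y ->
    ([set x; y] \in edges (F s)) = ((psi x, psi y) \in seq_edges s).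
  move=> sL xy; have /and3P[_ us /allP s_n] := Lok _ sL.
  have sK : map psi (map phi s) = s.
    by rewrite -map_comp map_id_in // => z /s_n z_n; exact: phiK.
  have stepsE a b : ((a, b) \in steps (map phi s)) = ((psi a, psi b) \in steps s).
    rewrite -[s in RHS]sK (steps_map psi).
    have psi2_inj : injective (fun p : V * V => (psi p.1, psi p.2)).
      by move=> [a1 b1] [a2 b2] [/psi_inj-> /psi_inj->].
    exact: (esym (mem_map psi2_inj (steps (map phi s)) (a, b))).
  rewrite seq_graph_edges ?usE // !stepsE mem_seq_edges // (_ : x != y) //.
  by apply: contraTneq xy => ->; rewrite ltnn.
(* Members of [map F L] may coincide, hence only an inequality. *)
exists [set P in map F L]; last by rewrite cardsE (leq_trans (card_size _)) ?size_map.
split=> [P|e eG].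
  rewrite inE => /mapP[s sL ->]; have /and3P[s0 us s_n] := Lok _ sL; split.
    by apply: seq_graph_path; rewrite ?usE //; apply: contraNneq s0; case: (s).
  rewrite /subgraph GT subsetT /=; apply/subsetP => e eF.
  have [x [y [xy eE]]] := edgeW _ _ eF; rewrite eE in eF *.
  rewrite FE // in eF; rewrite GR //.
  rewrite -[R _ _]lt0b -countE // -has_count has_pred1.
  by apply/flatten_mapP; exists s.
have [x [y [xy eE]]] := edgeW _ _ eG; rewrite {}eE in eG *.
have : (psi x, psi y) \in family_edges L by rewrite -has_pred1 has_count countE // -GR // eG.
case/flatten_mapP => s sL es; exists (F s); split.
  by rewrite inE map_f // FE.
move=> P []; rewrite inE => /mapP[s' s'L ->]; rewrite FE // => es'.
have [-> //|ss'] := eqVneq s s'.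
have := count_flatten_gt1 sL s'L ss' es es'.
by rewrite -/(family_edges L) countE // -GR // eG.
Qed.

(** * Labelling the vertices *)

(** Two enumerations of [V], one starting with the values of [f], the other with those of [g], are
    matched position by position. *)
Lemma extend_to_perm (I V : finType) (f g : I -> V) :
  injective f -> injective g -> exists p : {perm V}, forall i, p (f i) = g i.
Proof.
move=> f_inj g_inj.
pose l (h : I -> V) := codom h ++ enum [predC codom h].
have l_uniq h : injective h -> uniq (l h).
  move=> h_inj; rewrite cat_uniq enum_uniq andbT.
  rewrite (map_inj_uniq h_inj) enum_uniq /=.
  by apply/hasPn => x; rewrite mem_enum.
have l_all h x : x \in l h by rewrite mem_cat mem_enum inE orbN.
have l_size h : injective h -> size (l h) = #|V|.
  by move=> /l_uniq/card_uniqP <-; apply: eq_card => x; rewrite l_all.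
have p_inj : injective (fun x => nth x (l g) (index x (l f))).
  move=> x y; have ltV z : index z (l f) < size (l g).
    by rewrite l_size // -(l_size f) // index_mem.
  rewrite (set_nth_default y) //; move/eqP; rewrite nth_uniq ?l_uniq // => /eqP.
  by move/(congr1 (nth x (l f))); rewrite !nth_index.
exists (perm p_inj) => i; rewrite permE.
have iI : index i (enum I) < #|I| by rewrite cardE index_mem mem_enum.
have fiE : index (f i) (l f) = index i (enum I).
  by rewrite index_cat codom_f index_map.
by rewrite fiE nth_cat size_codom iI (nth_map i) ?nth_index ?mem_enum // -cardE.
Qed.

(* [cycle_edge] and [tadpole_edge] are only meaningful for x < y. *)
Definition cycle_edge (m : nat) : rel nat := fun x y =>
  (y < m) && [|| y == x + 2, (x == 0) && (y == 1) | (x == m - 2) && (y == m - 1)].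

Definition tadpole_edge (n m : nat) : rel nat := fun x y =>
  cycle_edge m x y || (x == ~~ odd n) && (y == n - 1).

(* The order in which the cycle is run through, from its vertex 0 and, if
   [back], from its vertex 1 in the opposite direction. *)
Definition cycle_vertex (back : bool) (m i : nat) : nat :=
  let j := if back then m - 1 - i else i in
  if 2 * j < m then 2 * j else 2 * (m - 1 - j) + 1.

Lemma cycle_vertex_lt back m i : i < m -> cycle_vertex back m i < m.
Proof. by rewrite /cycle_vertex; case: back => /=; case: ifP; lia. Qed.

Lemma cycle_vertex_inj back m i j : i < m -> j < m ->
  cycle_vertex back m i = cycle_vertex back m j -> i = j.
Proof. by rewrite /cycle_vertex; case: back => /=; do 2!case: ifP; lia. Qed.

Lemma cycle_vertex0 (back : bool) m : 3 <= m -> cycle_vertex back m 0 = back.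
Proof. by rewrite /cycle_vertex; case: back => /=; case: ifP; lia. Qed.

Lemma cycle_vertexP back m z : z < m -> exists2 i, i < m & cycle_vertex back m i = z.
Proof.
move=> zm; pose j := if odd z then m - 1 - z./2 else z./2.
exists (if back then m - 1 - j else j); rewrite /cycle_vertex /j.
  by case: back; case: (ifP (odd z)); lia.
by case: back; case: (ifP (odd z)); case: ifP; lia.
Qed.

Lemma cycle_vertex_edge back m i j : 3 <= m -> i < m -> j < m ->
  cycle_vertex back m i < cycle_vertex back m j ->
  cycle_edge m (cycle_vertex back m i) (cycle_vertex back m j) =
  (j == i.+1 %% m) || (i == j.+1 %% m).
Proof.
move=> m3 im jm.
have modE k : k < m -> k.+1 %% m = if k == m - 1 then 0 else k.+1.
  move=> km; case: eqP => [->|]; first by rewrite subn1 prednK ?modnn //; lia.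
  by move=> ?; rewrite modn_small //; lia.
rewrite !modE // /cycle_edge /cycle_vertex.
by case: back => /=; do 4!case: ifP; lia.
Qed.

(** The cycle receives the labels below m, the pendant vertex receives n - 1, and the vertices
    outside [T] share the rest. *)
Lemma tadpole_labelling (n m : nat) (T : graph 'I_n) :
  3 <= m -> m < n -> isomorphic T (tadpole_graph m) ->
  exists p : {perm 'I_n}, forall x y, p x < p y ->
    ([set x; y] \in edges T) = tadpole_edge n m (p x) (p y).
Proof.
move=> m3 mn [f [[h fK hK] fE]].
have n1_lt : n - 1 < n by lia.
(* As a number, [back] is the label that [tadpole_edge] prescribes for the cycle vertex carrying the
   pendant edge. *)
pose back := ~~ odd n.
pose lab (a : option 'I_m) : 'I_n :=
  if a is Some i then Ordinal (ltn_trans (cycle_vertex_lt back (ltn_ord i)) mn)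
  else Ordinal n1_lt.
pose wrap (a : option 'I_m) : {y | y \in vertices (tadpole_graph m)} :=
  exist (fun y => y \in vertices (tadpole_graph m)) a (in_setT a).
pose tau a := val (h (wrap a)).
have tau_inj : injective tau.
  by move=> a b /val_inj/(can_inj hK)/(congr1 val).
have lab_inj : injective lab.
  move=> [i|] [j|] // /(congr1 val) /=.
  - by move/cycle_vertex_inj => ij; congr Some; apply/val_inj/ij.
  - by have := cycle_vertex_lt back (ltn_ord i); lia.
  by have := cycle_vertex_lt back (ltn_ord j); lia.
have [p pE] := extend_to_perm tau_inj lab_inj.
have tauP x : x \in vertices T -> exists a, x = tau a.
  move=> xT; exists (val (f (exist _ x xT))); rewrite /tau (_ : wrap _ = f (exist _ x xT)).
    by rewrite fK.
  exact/val_inj.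
have T_vert x y : [set x; y] \in edges T -> (x \in vertices T) && (y \in vertices T).
  have /forall_inP Hax := valP T; move/Hax => /andP[/subsetP sub _].
  by rewrite !sub ?set21 ?set22.
have labP x : (p x < m) || (p x == n - 1 :> nat) -> exists a, x = tau a.
  case: ltnP => [/(cycle_vertexP back)[i im pxE] _|_ /eqP pxE].
    exists (Some (Ordinal im)); apply: (@perm_inj _ p); rewrite pE.
    exact/val_inj/esym.
  by exists None; apply: (@perm_inj _ p); rewrite pE; apply/val_inj.
exists p => x y xy.
(* If either side holds, both ends are vertices of [T]; for all other pairs both sides are false. *)
have tauE : ([set x; y] \in edges T) || tadpole_edge n m (p x) (p y) ->
    exists a b, x = tau a /\ y = tau b.
  case/orP => [/T_vert/andP[/tauP[a ->] /tauP[b ->]]|]; first by exists a, b.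
  have backE : (p x == ~~ odd n :> nat) -> p x < m by case: (odd n) => /= /eqP->; lia.
  move=> xyE; suff [/labP[a ->] /labP[b ->]] : ((p x < m) || (p x == n - 1 :> nat)) /\
      ((p y < m) || (p y == n - 1 :> nat)) by exists a, b.
  move: xyE; rewrite /tadpole_edge /cycle_edge.
  case/orP => [|/andP[/backE-> /eqP->]]; last by rewrite eqxx orbT.
  by move: xy; lia.
case: (boolP (_ || _)) (tauE) => [_ [//|a [b [xE yE]]]|]; last first.
  by rewrite negb_or => /andP[/negPf-> /negPf->].
move: xy; rewrite {}xE {}yE !pE fE !hK rel_graphE {labP tauE}.
case: a b => [i|] [j|] /=; rewrite /cycle_rel.
- move=> ij; rewrite -(@cycle_vertex_edge back) // (_ : Some i != Some j) /tadpole_edge.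
    rewrite (_ : _ == n - 1 = false) ?andbF ?orbF //.
    by have := cycle_vertex_lt back (ltn_ord j); lia.
  by apply: contraTneq ij => -[->]; rewrite ltnn.
- move=> _; rewrite orbF /tadpole_edge /= eqxx andbT /cycle_edge.
  have -> : n - 1 < m = false by lia.
  rewrite -/back -(cycle_vertex0 back m3); apply/eqP/eqP => [->|] //.
  by apply: cycle_vertex_inj => //; lia.
- by have := cycle_vertex_lt back (ltn_ord j); lia.
by rewrite ltnn.
Qed.

Lemma decomposition_of_seqs (n m : nat) (L : seq (seq nat)) (T : graph 'I_n) :
  3 <= m -> m < n -> isomorphic T (tadpole_graph m) ->
  seq_decomposition n (fun x y => ~~ tadpole_edge n m x y) L ->
  exists2 D : {set graph 'I_n},
    path_decomposition (del_edges (complete_graph n) (edges T)) D & #|D| <= size L.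
Proof.
move=> m3 mn isoT; have [p pE] := tadpole_labelling m3 mn isoT.
have n_gt0 : 0 < n by lia.
apply: (@seq_decompositionP _ _ _ _ (fun x => val (p x))
  (fun z => (p^-1)%g (insubd (Ordinal n_gt0) z))) => [x|x|z zn||x y xy].
- exact: ltn_ord.
- by rewrite valKd permK.
- by rewrite permKV val_insubd zn.
- by [].
rewrite inE rel_graphE pE // andbT (_ : x != y) ?andbT //.
by apply: contraTneq xy => ->; rewrite ltnn.
Qed.

(** * Zigzag paths *)

(** For c < k and t < 2k the ascending terms stay below 2k; only the descending ones may need
    reduction modulo 2k. *)
Definition zigzag (k c t : nat) : nat :=
  if odd t then c + t./2 + 1
  else if t./2 <= c then c - t./2 else c + 2 * k - t./2.

Definition zigzag_path (k c : nat) : seq nat := map (zigzag k c) (iota 0 (2 * k)).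

Lemma zigzag_lt k c t : c < k -> t < 2 * k -> zigzag k c t < 2 * k.
Proof. by rewrite /zigzag; do ?case: ifP => ?; lia. Qed.

Lemma zigzag_inj k c t u : c < k -> t < 2 * k -> u < 2 * k ->
  zigzag k c t = zigzag k c u -> t = u.
Proof. by rewrite /zigzag; do ?case: ifP => ?; lia. Qed.

(* Path [c] consists of the edges whose ends add up to [2c] or [2c+1] modulo
   [2k]; its consecutive differences are [1, 2, 3, ...] modulo [2k]. *)
Lemma zigzag_edge k c t x y : c < k -> t.+1 < 2 * k -> x < y -> y < 2 * k ->
  (norm_pair (zigzag k c t, zigzag k c t.+1) == (x, y)) =
  (c == if x + y < 2 * k then (x + y)./2 else (x + y)./2 - k) &&
  (t == if x + y < 2 * k then y - x - 1 else 2 * k - 1 - (y - x)).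
Proof.
move=> ck tk xy yk; rewrite /norm_pair xpair_eqE /= /zigzag.
by do ?case: ifP => ?; lia.
Qed.

Lemma steps_iota a l : steps (iota a l) = [seq (t, t.+1) | t <- iota a l.-1].
Proof. by case: l => // l; elim: l a => // l IH a; rewrite /steps /= in IH *; rewrite IH. Qed.

Lemma count_map_iota (A : eqType) (g : nat -> A) (e : A) l :
  count_mem e [seq g t | t <- iota 0 l] = \sum_(0 <= t < l) (g t == e).
Proof. by rewrite count_map -sum1_count big_mkcond /index_iota subn0. Qed.

Lemma sum_indicator (l i : nat) (P : pred nat) :
  i < l -> \sum_(0 <= t < l) ((t == i) && P t) = P i.
Proof.
move=> il; rewrite (bigD1_seq i) ?iota_uniq ?mem_index_iota //= eqxx.
by rewrite big1 ?addn0 // => j /negPf->.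
Qed.

Lemma zigzag_paths_cover k x y : x < y -> y < 2 * k ->
  \sum_(0 <= c < k) count_mem (x, y) (seq_edges (zigzag_path k c)) = 1.
Proof.
move=> xy yk.
(* Half the sum modulo 2k determines the path; the difference, subtracted from 2k if the sum wraps
   around, is one more than the position. *)
pose c0 := if x + y < 2 * k then (x + y)./2 else (x + y)./2 - k.
pose t0 := if x + y < 2 * k then y - x - 1 else 2 * k - 1 - (y - x).
have c0k : c0 < k by rewrite /c0; case: ifP; lia.
have t0k : t0 < (2 * k).-1 by rewrite /t0; case: ifP; lia.
rewrite -[RHS]/(true : nat) -(sum_indicator xpredT c0k); apply: eq_big_nat => c /andP[_ ck].
rewrite /seq_edges /zigzag_path steps_map steps_iota -!map_comp count_map_iota.
rewrite andbT -(sum_indicator (fun=> c == c0) t0k); apply: eq_big_nat => t /andP[_ tk].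
by rewrite /= zigzag_edge ?[RHS]andbC //; lia.
Qed.

(** * Removing the cycle *)

(** After the cuts, paths 0 and 1 start at 1 and 0, and every other path c still starts at c, so no
    end vertex is lost. The end vertices cut are 0, ..., m - 2. *)
Definition cut_front (m c : nat) : seq nat :=
  if c == 0 then [:: 1] else if c == 1 then [::] else
  if c <= m - 2 then [:: 0] else [:: 0; 1].

Definition cut_rear (k m c : nat) : seq nat :=
  if c + k <= m - 2 then [:: 2 * k - 1] else [:: 2 * k - 2; 2 * k - 1].

Definition cut_positions (k m c : nat) : seq nat :=
  cut_front m c ++ iota 2 (2 * k - 4) ++ cut_rear k m c.

Definition cut_path (k m c : nat) : seq nat := map (zigzag k c) (cut_positions k m c).

(* Cutting at the end vertex [i] removes [lost_edges i] and adds
   [gained_edges i]: for 2 <= i the path starts i, i - 1, i + 2, ... instead of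
   i, i + 1, i - 1, i + 2, ..., so the edge {i, i + 1} moves on to the path
   ending at i + 1. *)
Definition lost_edges (i : nat) : seq (nat * nat) :=
  if i == 0 then [:: (0, 1)] else if i == 1 then [:: (1, 2); (0, 2)] else
  [:: (i, i + 1); (i - 1, i + 1)].

Definition gained_edges (i : nat) : seq (nat * nat) :=
  if i <= 1 then [::] else [:: (i - 1, i)].

Lemma norm_pair_le a b : a <= b -> norm_pair (a, b) = (a, b).
Proof. by move=> ab; congr (_, _) => /=; lia. Qed.

Lemma norm_pairC a b : norm_pair (a, b) = norm_pair (b, a).
Proof. by rewrite /norm_pair /= minnC maxnC. Qed.

Lemma seq_edges_cat a u v :
  seq_edges (u ++ a :: v) = seq_edges (rcons u a) ++ seq_edges (a :: v).
Proof.
by rewrite /seq_edges -map_cat; congr map; elim: u => [|b [|c u] IH] //=;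
  rewrite /steps /= in IH *; rewrite IH.
Qed.

Lemma iota_ends a l : 0 < l -> exists u v,
  iota a l = a :: v /\ iota a l = rcons u (a + l - 1).
Proof.
case: l => // l _; exists (iota a l), (iota a.+1 l); split=> //.
by rewrite -{1}addn1 iotaD /= cats1 addnS subn1.
Qed.

Lemma iota_ends2 k : 2 <= k ->
  iota 0 (2 * k) = [:: 0; 1] ++ iota 2 (2 * k - 4) ++ [:: 2 * k - 2; 2 * k - 1].
Proof.
move=> k2; have {1}-> : 2 * k = 2 + ((2 * k - 4) + 2) by lia.
by rewrite iotaD iotaD /=; do 2!congr cons; congr (iota _ _ ++ [:: _; _]); lia.
Qed.

Lemma zigzag_ends k c : 3 <= k -> c < k ->
  [/\ zigzag k c 0 = c, zigzag k c 1 = c + 1,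
      zigzag k c 2 = if c == 0 then 2 * k - 1 else c - 1,
      zigzag k c (2 * k - 3) = c + k - 1 & zigzag k c (2 * k - 1) = c + k].
Proof.
rewrite /zigzag => k3 ck; split=> /=; rewrite ?subn0 ?addn0 //.
- by do ?case: ifP => ?; lia.
- by do ?case: ifP => ?; lia.
by do ?case: ifP => ?; lia.
Qed.

Lemma zigzag_penultimate k c : c.+1 < k -> zigzag k c (2 * k - 2) = c + k + 1.
Proof. by rewrite /zigzag => ck; do ?case: ifP => ?; lia. Qed.

(** Positions 2 to 2k - 3 survive every cut, so front and rear can be compared separately around an
    unchanged middle. Losses and gains stand on opposite sides to avoid truncated subtraction. *)
Lemma count_cut_path (k m c : nat) (e : nat * nat) :
  3 <= k -> 3 <= m <= 2 * k -> c < k ->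
  let lost i := if i < m - 1 then count_mem e (lost_edges i) else 0 in
  let gained i := if i < m - 1 then count_mem e (gained_edges i) else 0 in
  count_mem e (seq_edges (cut_path k m c)) + (lost c + lost (c + k)) =
  count_mem e (seq_edges (zigzag_path k c)) + (gained c + gained (c + k)).
Proof.
move=> k3 /andP[m3 m2k] ck lost gained.
have [z0 z1 z2 zr3 zr1] := zigzag_ends k3 ck.
(* Kept as an implication: for c = k - 1 this vertex is 0, but a rear cut forces c + 1 < k because m
   <= 2k. *)
have := @zigzag_penultimate k c.
rewrite /cut_path /zigzag_path; set z := zigzag k c in z0 z1 z2 zr3 zr1 * => zr2.
have k4 : 0 < 2 * k - 4 by lia.
have [u [v [Mv Mu]]] := iota_ends 2 k4.
have catE f r : count_mem e (seq_edges (map z (f ++ iota 2 (2 * k - 4) ++ r))) =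
    count_mem e (seq_edges (rcons (map z f) (z 2))) +
    count_mem e (seq_edges (map z (iota 2 (2 * k - 4)))) +
    count_mem e (seq_edges (z (2 * k - 3) :: map z r)).
  rewrite map_cat {1}Mv seq_edges_cat count_cat -addnA; congr (_ + _).
  rewrite -[z 2 :: _]/(map z ((2 :: v) ++ r)) -Mv Mu cat_rcons map_cat /= seq_edges_cat.
  rewrite count_cat map_rcons.
  by congr (count_mem e (seq_edges (rcons _ (z _))) +
            count_mem e (seq_edges (z _ :: _))); lia.
have frontE : count_mem e (seq_edges (rcons (map z (cut_front m c)) (z 2))) + lost c =
    count_mem e (seq_edges (rcons (map z [:: 0; 1]) (z 2))) + gained c.
  rewrite /cut_front /lost /gained /lost_edges /gained_edges {catE Mv Mu}.
  case: eqP => [c0|c0]; last case: eqP => [c1|c1]; last case: ifP => cm.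
  - have -> : c < m - 1 by lia.
    have -> : c <= 1 by lia.
    by case: (e) => x y; rewrite /= !z1 z0 z2 c0 /= !xpair_eqE /=; lia.
  - have -> : c < m - 1 by lia.
    have -> : c <= 1 by lia.
    by case: (e) => x y; rewrite /= !z1 z0 z2 c1 /= !xpair_eqE /=; lia.
  - have -> : c < m - 1 by lia.
    have -> : c <= 1 = false by lia.
    have z2' : z 2 = c - 1 by rewrite z2; case: eqP.
    rewrite /seq_edges /= z1 z0 z2' norm_pairC [norm_pair (c + 1, _)]norm_pairC.
    by rewrite !norm_pair_le; lia.
  by have -> : c < m - 1 = false by lia.
have rearE : count_mem e (seq_edges (z (2 * k - 3) :: map z (cut_rear k m c))) +
      lost (c + k) =
    count_mem e (seq_edges (z (2 * k - 3) :: map z [:: 2 * k - 2; 2 * k - 1])) +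
      gained (c + k).
  rewrite /cut_rear /lost /gained /lost_edges /gained_edges {catE Mv Mu}.
  case: ifP => ckm; last by have -> : c + k < m - 1 = false by lia.
  have -> : c + k < m - 1 by lia.
  have -> : c + k <= 1 = false by lia.
  have -> : (c + k == 0) = false by lia.
  have -> : (c + k == 1) = false by lia.
  have {}zr2 : z (2 * k - 2) = c + k + 1 by apply: zr2; lia.
  rewrite /seq_edges /= zr3 zr2 zr1 [norm_pair (c + k + 1, _)]norm_pairC.
  by rewrite !norm_pair_le; lia.
rewrite (iota_ends2 (ltnW k3)) /cut_positions !catE.
by move: frontE rearE; lia.
Qed.

(** Passing from C_(i+1) to C_(i+2) replaces the edge {i - 1, i} by the path i - 1, i + 1, i. *)
Lemma cycle_edge_step i x y : 2 <= i -> x < y ->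
  cycle_edge (i + 1) x y + count_mem (x, y) (lost_edges i) =
  count_mem (x, y) (gained_edges i) + cycle_edge (i + 2) x y.
Proof.
rewrite /lost_edges /gained_edges; case: i => [|[|i]] //= _ xy.
rewrite /cycle_edge !xpair_eqE.
have [yi|yi|->] := ltngtP y i.+2; first by lia.
  have [yi'|->] : i.+3 < y \/ y = i.+3; [by lia|by lia|].
  by have [?|?|->] := ltngtP x i.+1; lia.
by have [?|?|->] := ltngtP x i.+1; lia.
Qed.

Lemma cycle_edges_telescope m x y : 3 <= m -> x < y ->
  \sum_(0 <= i < m - 1) count_mem (x, y) (lost_edges i) =
  \sum_(0 <= i < m - 1) count_mem (x, y) (gained_edges i) + cycle_edge m x y.
Proof.
move=> m3 xy; have -> : m = (m - 3) + 3 by lia.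
(* For m = 3 the cuts at 0 and 1 remove just the triangle and add nothing. *)
elim: (m - 3) => [|l IH].
  by rewrite /index_iota /= !big_cons !big_nil /= !xpair_eqE /cycle_edge /=; lia.
have -> : l.+1 + 3 - 1 = (l + 3 - 1).+1 by lia.
rewrite !big_nat_recr //= IH -!addnA; congr (_ + _).
have -> : l + 3 = (l + 3 - 1) + 1 by lia.
have -> : l.+1 + 3 = (l + 3 - 1) + 2 by lia.
by rewrite addnK cycle_edge_step //; lia.
Qed.

Lemma cut_paths_cover k m x y : 3 <= k -> 3 <= m <= 2 * k -> x < y -> y < 2 * k ->
  \sum_(0 <= c < k) count_mem (x, y) (seq_edges (cut_path k m c)) =
  ~~ cycle_edge m x y.
Proof.
move=> k3 mk xy yk; have /andP[m3 m2k] := mk.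
(* The ends c and c + k, for c < k, run exactly once through the labels below 2k, so a sum over
   paths becomes a sum over end vertices. *)
have sum2 (g : nat -> nat) :
    \sum_(0 <= c < k) ((if c < m - 1 then g c else 0) +
                       (if c + k < m - 1 then g (c + k) else 0)) =
    \sum_(0 <= i < m - 1) g i.
  rewrite big_split /= (big_nat_widen 0 (m - 1) (2 * k)) //; last by lia.
  rewrite [RHS]big_mkcond mul2n -addnn [RHS](big_cat_nat (leq0n k)) ?leq_addr //=.
  by congr (_ + _); rewrite -[X in _ = \sum_(X <= _ < _) _]add0n big_addn addnK.
have := zigzag_paths_cover xy yk; have := cycle_edges_telescope m3 xy.
rewrite -!sum2.
set S1 := \sum_(0 <= c < k) _; set S2 := \sum_(0 <= c < k) _ => S12 S3.
have : S1 + \sum_(0 <= c < k) count_mem (x, y) (seq_edges (cut_path k m c)) =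
   S2 + \sum_(0 <= c < k) count_mem (x, y) (seq_edges (zigzag_path k c)).
  rewrite -!big_split /=; apply: eq_big_nat => c /andP[_ ck].
  by rewrite addnC count_cut_path // addnC.
by rewrite S3 S12; lia.
Qed.

(** * Even order *)

Lemma cut_path_ok k m c : 3 <= k -> c < k ->
  [&& cut_path k m c != [::], uniq (cut_path k m c) & all (gtn (2 * k)) (cut_path k m c)].
Proof.
move=> k3 ck.
have sub : subseq (cut_positions k m c) (iota 0 (2 * k)).
  rewrite (iota_ends2 (ltnW k3)).
  rewrite /cut_positions /cut_front /cut_rear !cat_subseq //.
    by do ?case: ifP => _; rewrite ?sub0seq ?subseq_refl ?(subseq_cons [:: 1] 0).
  by case: ifP => // _; exact: subseq_cons.
have lt2k t : t \in cut_positions k m c -> t < 2 * k.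
  by move/(mem_subseq sub); rewrite mem_iota.
apply/and3P; split.
- by rewrite -size_eq0 size_map !size_cat size_iota; lia.
- rewrite map_inj_in_uniq ?(subseq_uniq sub) ?iota_uniq // => t u /lt2k tk /lt2k uk.
  exact: zigzag_inj.
by apply/allP => _ /mapP[t /lt2k tk ->]; exact: zigzag_lt.
Qed.

Lemma family_edges_cons s L : family_edges (s :: L) = seq_edges s ++ family_edges L.
Proof. by []. Qed.

Lemma count_family_edges (f : nat -> seq nat) e a b :
  count_mem e (family_edges (map f (index_iota a b))) =
  \sum_(a <= c < b) count_mem e (seq_edges (f c)).
Proof.
by rewrite /family_edges count_flatten sumnE -!map_comp !big_map.
Qed.

Lemma seq_decompositionI n (R : rel nat) L :
  (forall s, s \in L -> [&& s != [::], uniq s & all (gtn n) s]) ->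
  (forall x y, x < y -> y < n -> count_mem (x, y) (family_edges L) = R x y) ->
  seq_decomposition n R L.
Proof.
move=> Lok LR; apply/andP; split; first exact/allP.
apply/allP => y; rewrite mem_iota => yn; apply/allP => x; rewrite mem_iota => xy.
by rewrite LR.
Qed.

(** The cut at 0 makes path 0 start with 1, 2k - 1, so dropping its first vertex deletes exactly the
    pendant edge. *)
Definition even_family (k m : nat) : seq (seq nat) :=
  behead (cut_path k m 0) :: map (cut_path k m) (index_iota 1 k).

Lemma even_familyP k m : 3 <= k -> 3 <= m <= 2 * k - 1 ->
  seq_decomposition (2 * k) (fun x y => ~~ tadpole_edge (2 * k) m x y) (even_family k m).
Proof.
move=> k3 /andP[m3 mk].
have k4 : 0 < 2 * k - 4 by lia.
have [u [v [Mv _]]] := iota_ends 2 k4.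
have z1 : zigzag k 0 1 = 1 by [].
have z2 : zigzag k 0 2 = 2 * k - 1 by rewrite /zigzag /=; lia.
have head0 : exists s, cut_path k m 0 = [:: 1, 2 * k - 1 & s].
  exists (map (zigzag k 0) (v ++ cut_rear k m 0)).
  by rewrite /cut_path /cut_positions Mv /= z2.
have [s0 cut0] := head0.
apply: seq_decompositionI => [s|x y xy yk].
  rewrite in_cons => /orP[/eqP->|/mapP[c]]; last first.
    by rewrite mem_index_iota => /andP[_ ck] ->; exact: cut_path_ok.
  have /(@cut_path_ok k m 0 k3) : 0 < k by lia.
  by rewrite cut0 /= => /and3P[/andP[_ ->] _ ->].
have := @cut_paths_cover k m x y k3 _ xy yk; rewrite big_ltn ?cut0; last by lia.
rewrite /even_family cut0 family_edges_cons count_cat count_family_edges.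
rewrite -[seq_edges [:: 1, _ & _]]/(norm_pair (1, 2 * k - 1) :: seq_edges (2 * k - 1 :: s0)).
rewrite norm_pair_le /= ?xpair_eqE; last by lia.
rewrite /tadpole_edge oddM /= /cycle_edge.
set S1 := count_mem _ _; set S2 := \sum_(_ <= _ < _) _.
have m2k : 2 < m <= 2 * k by lia.
by move/(_ m2k); lia.
Qed.

(** * Odd order *)

(** Joining both ends of u, a, b, v to [w] gives a cycle; b, v, w, u, a is this cycle opened at {a,
    b}. *)
Lemma seq_edges_rotate (u v : seq nat) (a b w : nat) :
  perm_eq (norm_pair (a, b) :: seq_edges (b :: v ++ w :: rcons u a))
    (norm_pair (last b v, w) :: norm_pair (head a u, w) :: seq_edges (rcons u a ++ b :: v)).
Proof.
have -> : seq_edges (rcons u a ++ b :: v) =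
    seq_edges (rcons u a) ++ norm_pair (a, b) :: seq_edges (b :: v).
  by rewrite cat_rcons seq_edges_cat.
have -> : seq_edges (b :: v ++ w :: rcons u a) =
    seq_edges (b :: v) ++ norm_pair (last b v, w) :: norm_pair (head a u, w) ::
    seq_edges (rcons u a).
  rewrite -cat_cons seq_edges_cat {1}lastI -cats1 cat_rcons seq_edges_cat -lastI -catA /=.
  by congr (_ ++ _ :: _); case: u => [|c u]; rewrite [LHS]/= norm_pairC.
by apply/seq.permP => P; rewrite /= !count_cat /=; lia.
Qed.

(* The path [0, 5, 2, 7, 4, 9, ...] has one edge in each of the zigzag paths
   [2, 3, ..., k - 1, 0], in this order; [crossing k c] is the position in
   path [c] at which that edge starts. *)
Definition rainbow (j : nat) : nat := if odd j then j + 4 else j.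

Arguments rainbow : simpl never.

Definition crossing (k c : nat) : nat :=
  if c == 0 then (if odd k then 2 * k - 4 else 2 * k - 6)
  else if odd c then 2 else 4.

Definition crossing_edge (k c : nat) : nat * nat :=
  norm_pair (zigzag k c (crossing k c), zigzag k c (crossing k c).+1).

(** The two labels add up to 2j + 5, which modulo 2k singles out path j + 2, or path 0 for j = k -
    2. They differ by 5 or 3, hence the positions 4 and 2, or 2k - 6 and 2k - 4 when the sum wraps
    around. *)
Lemma rainbow_edge k j : 4 <= k -> j < k - 1 ->
  norm_pair (rainbow j, rainbow j.+1) = crossing_edge k (if j == k - 2 then 0 else j + 2).
Proof.
move=> k4 jk; rewrite /crossing_edge /crossing /rainbow.
by do ?case: ifP => ?; rewrite /zigzag; do ?case: ifP => ?;
  congr (_, _); rewrite /=; do ?case: ifP => ?; lia.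
Qed.

(** This is the cut path closed to a cycle through 2k and opened at its crossing edge. *)
Definition rerouted_path (k m c : nat) : seq nat :=
  let t := crossing k c in
  map (zigzag k c) (iota t.+1 (2 * k - 3 - t) ++ cut_rear k m c) ++
  2 * k :: map (zigzag k c) (cut_front m c ++ iota 2 (t - 1)).

(** Both ends of the crossing edge thus lie among positions 2 to 2k - 3, untouched by the cuts. For
    k = 3 position 4 would be too late. *)
Lemma crossing_bounds k c : 4 <= k -> 2 <= crossing k c <= 2 * k - 4.
Proof. by rewrite /crossing; do ?case: ifP => ?; lia. Qed.

Lemma cut_positions_split k m c t : 2 <= t <= 2 * k - 4 ->
  cut_positions k m c =
  (cut_front m c ++ iota 2 (t - 1)) ++ iota t.+1 (2 * k - 3 - t) ++ cut_rear k m c.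
Proof.
move=> tk; rewrite /cut_positions -!catA [iota 2 (t - 1) ++ _]catA.
have -> : t.+1 = 2 + (t - 1) by lia.
by rewrite -iotaD; congr (_ ++ iota _ _ ++ _); lia.
Qed.

Lemma rerouted_perm k m c : 4 <= k ->
  perm_eq (rerouted_path k m c) (2 * k :: cut_path k m c).
Proof.
move=> k4; rewrite /cut_path (cut_positions_split m c (crossing_bounds c k4)).
rewrite /rerouted_path; cbv zeta.
by rewrite perm_catC [X in perm_eq _ (_ :: X)]map_cat.
Qed.

Lemma cut_path_head k m c : 4 <= k -> c < k -> c != 1 ->
  head (zigzag k c 2) (map (zigzag k c) (cut_front m c)) = if c == 0 then 1 else c.
Proof.
move=> k4 ck /negPf c1; have [z0 z1 _ _ _] := @zigzag_ends k c (ltnW k4) ck.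
rewrite /cut_front c1; case: eqP => [->|] //.
by case: ifP.
Qed.

Lemma rerouted_edges k m c : 4 <= k -> c < k -> c != 1 ->
  perm_eq (crossing_edge k c :: seq_edges (rerouted_path k m c))
    (norm_pair (c + k, 2 * k) :: norm_pair (if c == 0 then 1 else c, 2 * k) ::
     seq_edges (cut_path k m c)).
Proof.
move=> k4 ck c1; have tb := crossing_bounds c k4.
have [_ _ _ _ zr1] := @zigzag_ends k c (ltnW k4) ck.
rewrite /cut_path (cut_positions_split m c tb) -(cut_path_head m k4 ck c1).
rewrite /rerouted_path; cbv zeta; set t := crossing k c in tb *; set z := zigzag k c in zr1 *.
have -> : 2 * k - 3 - t = (2 * k - 4 - t).+1 by lia.
have [t' tE] : exists t', t = t'.+2 by exists (t - 2); lia.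
have -> : iota 2 (t - 1) = rcons (iota 2 t') t.
  have -> : t - 1 = t' + 1 by lia.
  by rewrite iotaD cats1; congr rcons; lia.
rewrite -rcons_cat !map_cat map_rcons /=.
set u := map z (cut_front m c ++ _); set v := map z _ ++ map z _.
have -> : head (z 2) (map z (cut_front m c)) = head (z t) u.
  rewrite /u map_cat; case: (map z _) => //=.
  by rewrite tE; case: (t').
have -> : c + k = last (z t.+1) v.
  by rewrite /v /cut_rear; case: ifP; rewrite last_cat /= zr1.
exact: seq_edges_rotate.
Qed.

Lemma cut_path_rcons_edges k m c : 3 <= k -> c < k ->
  seq_edges (rcons (cut_path k m c) (2 * k)) =
  rcons (seq_edges (cut_path k m c)) (norm_pair (c + k, 2 * k)).
Proof.
move=> k3 ck; have [_ _ _ _ zr1] := zigzag_ends k3 ck.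
have [s ->] : exists s, cut_path k m c = rcons s (c + k).
  rewrite -zr1 /cut_path /cut_positions /cut_rear; case: ifP => _.
    by exists (map (zigzag k c) (cut_front m c ++ iota 2 (2 * k - 4)));
      rewrite catA cats1 map_rcons.
  exists (map (zigzag k c) ((cut_front m c ++ iota 2 (2 * k - 4)) ++ [:: 2 * k - 2])).
  by rewrite -map_rcons -cats1 -!catA.
by rewrite -[rcons (rcons s _) _]cats1 cat_rcons seq_edges_cat -[RHS]cats1.
Qed.

(** Path 1 is the one starting at 0 after the cuts, so extending only its other end omits the
    pendant edge {0, 2k}. The rainbow path takes one edge from each of the others. *)
Definition odd_family (k m : nat) : seq (seq nat) :=
  [:: map rainbow (iota 0 k), rcons (cut_path k m 1) (2 * k), rerouted_path k m 0 &
   map (rerouted_path k m) (index_iota 2 k)].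

Lemma count_rainbow k e : 4 <= k ->
  count_mem e (seq_edges (map rainbow (iota 0 k))) =
  (crossing_edge k 0 == e) + \sum_(2 <= c < k) (crossing_edge k c == e).
Proof.
move=> k4; rewrite /seq_edges steps_map steps_iota -!map_comp count_map_iota.
have -> : k.-1 = (k - 2).+1 by lia.
rewrite big_nat_recr //= addnC (rainbow_edge k4) ?eqxx //; last by lia.
congr (_ + _); rewrite -[X in _ = \sum_(X <= _ < _) _]add0n big_addn.
apply: eq_big_nat => j /andP[_ jk]; rewrite /= (rainbow_edge k4); last by lia.
by have -> : (j == k - 2) = false by lia.
Qed.

Lemma mem_seq_edges_lt n s x y : all (gtn n) s -> x < y -> (x, y) \in seq_edges s -> y < n.
Proof.
move=> /allP s_n xy; rewrite mem_seq_edges // (steps_nth 0).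
case/orP=> /mapP[i]; rewrite mem_iota add0n => /andP[_ i_s] [uE vE]; apply: s_n.
  by rewrite vE mem_nth -?ltn_predRL.
by rewrite uE mem_nth ?(leq_trans i_s (leq_pred _)).
Qed.

Lemma sum_eq a b x : \sum_(a <= c < b) (c == x) = (a <= x < b).
Proof.
rewrite -big_mkcond /= sum1_count (eq_count (a2 := pred1 x)) //.
by rewrite count_uniq_mem ?iota_uniq // mem_index_iota.
Qed.

(** The edges of the rainbow path are exactly those at which the cycles were opened, so they cancel.
    The cut paths remain, with the edges from 2k to all their ends except 0. *)
Lemma count_odd_family k m e : 4 <= k ->
  count_mem e (family_edges (odd_family k m)) =
  \sum_(0 <= c < k) count_mem e (seq_edges (cut_path k m c)) +
  \sum_(0 <= c < k) ((c + k, 2 * k) == e) +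
  ((1, 2 * k) == e) + \sum_(2 <= c < k) ((c, 2 * k) == e).
Proof.
move=> k4; have k3 := ltnW k4.
rewrite /odd_family !family_edges_cons !count_cat count_rainbow // count_family_edges.
have reroutedE c : c < k -> c != 1 ->
    (crossing_edge k c == e) + count_mem e (seq_edges (rerouted_path k m c)) =
    count_mem e (seq_edges (cut_path k m c)) + ((c + k, 2 * k) == e) +
    ((if c == 0 then 1 else c, 2 * k) == e).
  move=> ck c1; have /seq.permP/(_ (pred1 e)) := rerouted_edges m k4 ck c1.
  by rewrite /= !norm_pair_le; [lia|case: eqP; lia|lia].
have sumE : \sum_(2 <= c < k) (crossing_edge k c == e) +
    \sum_(2 <= c < k) count_mem e (seq_edges (rerouted_path k m c)) =
    \sum_(2 <= c < k) count_mem e (seq_edges (cut_path k m c)) +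
    \sum_(2 <= c < k) ((c + k, 2 * k) == e) + \sum_(2 <= c < k) ((c, 2 * k) == e).
  rewrite -!big_split; apply: eq_big_nat => c /andP[c2 ck].
  by rewrite [LHS]reroutedE ?(ltn_eqF c2) //; case: c c2 {ck} => [|[]].
have zeroE := reroutedE 0 (ltn_trans (isT : 0 < 2) k3) isT.
rewrite cut_path_rcons_edges //; last by lia.
rewrite -cats1 count_cat /= norm_pair_le; last by lia.
have split2 g : \sum_(0 <= c < k) g c = g 0 + g 1 + \sum_(2 <= c < k) g c.
  have [k0 k1] : 0 < k /\ 1 < k by lia.
  by rewrite (big_ltn k0) (big_ltn k1) addnA.
rewrite !split2; move: sumE zeroE; rewrite [if 0 == 0 then _ else _]/=.
do !move: (\sum_(2 <= c < k) _) => ?; do !move: (count_mem e _) => ?.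
by do !move: (nat_of_bool (_ == e)) => ?; lia.
Qed.

Lemma rainbow_inj : injective rainbow.
Proof. by move=> i j; rewrite /rainbow; do 2!case: ifP; lia. Qed.

Lemma odd_familyP k m : 4 <= k -> 3 <= m <= 2 * k ->
  seq_decomposition (2 * k + 1) (fun x y => ~~ tadpole_edge (2 * k + 1) m x y)
    (odd_family k m).
Proof.
move=> k4 mk; have k3 := ltnW k4; have /andP[m3 m2k] := mk.
have q_ok c : c < k -> [&& rerouted_path k m c != [::], uniq (rerouted_path k m c) &
    all (gtn (2 * k + 1)) (rerouted_path k m c)].
  move=> /(cut_path_ok m k3)/and3P[_ us /allP s_lt].
  have q_perm := rerouted_perm m c k4.
  rewrite -size_eq0 (perm_size q_perm) (perm_uniq q_perm) (perm_all _ q_perm) /= us andbT.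
  rewrite addn1 ltnSn; apply/andP; split; first by apply/negP => /s_lt; rewrite /= ltnn.
  by apply/allP => z /s_lt; exact: ltnW.
apply: seq_decompositionI => [s|x y xy yk].
  rewrite !in_cons => /or4P[/eqP->|/eqP->|/eqP->|/mapP[c]].
  - rewrite -size_eq0 size_map size_iota (map_inj_uniq rainbow_inj) iota_uniq.
    apply/andP; split; first by lia.
    apply/allP => _ /mapP[j + ->]; rewrite mem_iota /rainbow /= => jk.
    by case: ifP; lia.
  - have /(cut_path_ok m k3)/and3P[_ us /allP s_lt] : 1 < k by lia.
    rewrite -size_eq0 size_rcons rcons_uniq us all_rcons /= addn1 ltnSn andbT /=.
    apply/andP; split; first by apply/negP => /s_lt; rewrite /= ltnn.
    by apply/allP => z /s_lt; exact: ltnW.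
  - by apply: q_ok; lia.
  by rewrite mem_index_iota => /andP[_ ck] ->; exact: q_ok.
rewrite count_odd_family // /tadpole_edge oddD oddM /= addnK.
(* Below 2k only the cut paths contribute; at y = 2k only the new edges do, as m <= 2k keeps the
   cycle away from 2k. *)
have [->|yk'] := eqVneq y (2 * k); last first.
  have neE a : (a, 2 * k) == (x, y) = false by rewrite xpair_eqE [_ == y]eq_sym (negPf yk') andbF.
  rewrite cut_paths_cover //; last by lia.
  rewrite andbF orbF neE !big1 ?addn0 // => c _; by rewrite neE.
rewrite big_nat big1 => [|c /andP[_ ck]]; last first.
  have /and3P[_ _ s_lt] := cut_path_ok m k3 ck.
  apply/count_memPn/negP => /(mem_seq_edges_lt s_lt); lia.
have -> : cycle_edge m x (2 * k) = false by rewrite /cycle_edge; lia.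
rewrite !xpair_eqE eqxx andbT.
under eq_bigr do rewrite xpair_eqE eqxx andbT.
under [X in _ + X]eq_bigr do rewrite xpair_eqE eqxx andbT.
have -> : \sum_(0 <= c < k) (c + k == x) = (k <= x < 2 * k).
  rewrite -sum_eq -[X in _ = \sum_(X <= _ < _) _]add0n big_addn.
  by have -> : 2 * k - k = k by lia.
by rewrite sum_eq; lia.
Qed.

(** * Small orders and conclusion *)

Definition small_family (n m : nat) : seq (seq nat) :=
  match n, m with
  | 4, _ => [:: [:: 0; 3; 2]]
  | 5, 3 => [:: [:: 1; 4; 2; 3; 0]; [:: 1; 3; 4]]
  | 5, _ => [:: [:: 1; 2; 4; 3; 0]; [:: 1; 4]]
  | _, 3 => [:: [:: 5; 6; 1; 3; 2; 4; 0]; [:: 1; 5; 4; 6; 3; 0];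
                [:: 6; 2; 5; 3; 4; 1]; [:: 0; 5]]
  | _, 4 => [:: [:: 0; 3; 5; 2; 1; 4; 6]; [:: 2; 4; 5; 6; 3];
                [:: 2; 6; 1; 5; 0; 4; 3]]
  | _, 5 => [:: [:: 2; 6; 1; 4; 5; 0; 3]; [:: 1; 2; 3; 5; 6; 4; 0];
                [:: 3; 6]; [:: 1; 5; 2]]
  | _, _ => [:: [:: 4; 6; 1; 5; 2; 3; 0]; [:: 5; 0; 4; 3; 6; 2; 1];
                [:: 5; 6]; [:: 1; 4]]
  end.

Lemma seq_decomposition_exists n m : 3 <= m -> m < n -> exists2 L,
  seq_decomposition n (fun x y => ~~ tadpole_edge n m x y) L & size L <= (n + 1) %/ 2.
Proof.
(* The even construction needs k >= 3 and the odd one k >= 4; as n >= 4, this excludes exactly 4, 5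
   and 7. *)
move=> m3 mn; have [n_small|n_big] := boolP (n \in [:: 4; 5; 7]).
  exists (small_family n m);
    by move: n_small mn m3; rewrite !inE => /or3P[] /eqP->; do 7!case: m => [|m] //.
have n_neq : n <> 4 /\ n <> 5 /\ n <> 7 by move: n_big; rewrite !inE; lia.
(* The odd family has 3 + (k - 2) = k + 1 members, the even one 1 + (k - 1) = k. *)
case: (boolP (odd n)) => n_odd.
  exists (odd_family n./2 m).
    have {1 2}-> : n = 2 * n./2 + 1 by lia.
    by apply: odd_familyP; lia.
  by rewrite /= size_map size_iota; lia.
exists (even_family n./2 m).
  have {1 2}-> : n = 2 * n./2 by lia.
  by apply: even_familyP; lia.
by rewrite /= size_map size_iota; lia.
Qed.

Theorem theorem2 (n m : nat) (hn : 2 <= n) (hm : 3 <= m <= n - 1)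
    (T : graph 'I_n) (hT : subgraph T (complete_graph n))
    (hiso : isomorphic T (tadpole_graph m)) :
  exists2 D : {set graph 'I_n},
    path_decomposition (del_edges (complete_graph n) (edges T)) D &
    #|D| <= (n + 1) %/ 2.
Proof.
have [m3 mn] : 3 <= m /\ m < n by lia.
have [L Ldec L_size] := seq_decomposition_exists m3 mn.
have [D Dpath D_size] := decomposition_of_seqs m3 mn hiso Ldec.
by exists D => //; exact: leq_trans D_size L_size.
Qed.
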